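(* Let $M$ be a mixed graph of order $n\ge3$ without isolated vertices, with underlying graph $M_U$, and let $\mu_1\ge\cdots\ge\mu_n$ be the eigenvalues of $R_H(M)$. Then $$\sqrt{\frac{2n}{n-1}}\le\mathcal{E}_{R_H}(M)\le n.$$ Equality in the upper bound holds if and only if $n$ is even and $M_U$ is the disjoint union of $n/2$ paths of length $1$. Equality in the lower bound holds if and only if $M_U$ is a complete graph and $\mu_1=-\mu_n\neq0$, $\mu_j=0$ for $j=2,\dots,n-1$.
   Context: A mixed graph $M$ is obtained from a simple graph $M_U$ by orienting some of its edges; degrees $d_k$ are taken in $M_U$. The Hermitian-Randić matrix $R_H(M)$ has $(k,l)$ entry $\frac{1}{\sqrt{d_kd_l}}$ if $v_kv_l$ is an undirected edge, $\frac{\mathrm{i}}{\sqrt{d_kd_l}}$ if $(v_k,v_l)$ is an arc, $\frac{-\mathrm{i}}{\sqrt{d_kd_l}}$ if $(v_l,v_k)$ is an arc, and $0$ otherwise. $\mathcal{E}_{R_H}(M)=\sum_{i=1}^n|\mu_i|$. *)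

(* Defs.v *)
From HB Require Import structures.
From mathcomp Require Import all_boot all_order all_algebra.
From mathcomp Require Import complex.

Set Implicit Arguments.
Unset Strict Implicit.
Unset Printing Implicit Defensive.
Import Order.TTheory GRing.Theory Num.Theory.
Local Open Scope ring_scope.
Local Open Scope complex_scope.

Record sgraph (T : finType) := SGraph {
  adj :> rel T;
  adj_sym : symmetric adj;
  adj_irrefl : irreflexive adj
}.

Definition deg (T : finType) (G : sgraph T) (u : T) : nat := #|[set v | G u v]|.

Definition no_isolated (T : finType) (G : sgraph T) : Prop :=
  forall u, (0 < deg G u)%N.

Definition complete_graph (T : finType) (G : sgraph T) : Prop :=
  forall u v, u != v -> G u v.

Definition sgraph_iso (T U : finType) (G : sgraph T) (H : sgraph U) : Prop :=
  exists2 f : T -> U, bijective f & forall u v, G u v = H (f u) (f v).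

(* The path of length l, that is, with l edges and l + 1 vertices. *)
Definition path_rel l (i j : 'I_l.+1) : bool := (i.+1 == j) || (j.+1 == i).

Lemma path_rel_sym l : symmetric (@path_rel l).
Proof. by move=> i j; rewrite /path_rel orbC. Qed.

Lemma path_rel_irrefl l : irreflexive (@path_rel l).
Proof. by move=> i; rewrite /path_rel orbb gtn_eqF. Qed.

Definition path_graph l : sgraph 'I_l.+1 :=
  SGraph (@path_rel_sym l) (@path_rel_irrefl l).

Section Copies.
Variables (m : nat) (T : finType) (G : sgraph T).

Definition copies_rel (x y : 'I_m * T) : bool := (x.1 == y.1) && G x.2 y.2.

Lemma copies_rel_sym : symmetric copies_rel.
Proof. by move=> x y; rewrite /copies_rel eq_sym adj_sym. Qed.

Lemma copies_rel_irrefl : irreflexive copies_rel.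
Proof. by move=> x; rewrite /copies_rel adj_irrefl andbF. Qed.

(* The disjoint union of m copies of G. *)
Definition copies : sgraph ('I_m * T)%type :=
  SGraph copies_rel_sym copies_rel_irrefl.
End Copies.

(* [arc u v] holds when the edge uv of the underlying graph is oriented from u
   to v; the edges with neither orientation remain undirected. *)
Record mixed_graph (T : finType) := MixedGraph {
  underlying : sgraph T;
  arc : rel T;
  arc_adj : forall u v, arc u v -> underlying u v;
  arc_asym : forall u v, arc u v -> ~~ arc v u
}.

Definition undirected (T : finType) (M : mixed_graph T) (u v : T) : bool :=
  [&& underlying M u v, ~~ arc M u v & ~~ arc M v u].

Definition herm_randic (R : rcfType) (n : nat) (M : mixed_graph 'I_n) :
    'M[R[i]]_n :=
  \matrix_(k, l)
    let w : R := (Num.sqrt (deg (underlying M) k * deg (underlying M) l)%:R)^-1 in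
    if undirected M k l then w%:C
    else if arc M k l then 'i * w%:C
    else if arc M l k then - 'i * w%:C
    else 0.

(* [mu] lists, in non-increasing order, the eigenvalues of A with their
   (algebraic) multiplicities. *)
Definition is_real_spectrum (R : rcfType) (n : nat) (A : 'M[R[i]]_n)
    (mu : n.-tuple R) : Prop :=
  sorted >=%R mu /\ char_poly A = \prod_(x <- mu) ('X - (x%:C)%:P).

Definition energy (R : rcfType) (n : nat) (mu : n.-tuple R) : R :=
  \sum_(x <- mu) `|x|.

Lemma herm_randic_herm (R : rcfType) (n : nat) (M : mixed_graph 'I_n) :
  herm_randic R M \is hermsymmx.
Proof.
apply/is_hermitianmxP; rewrite expr0 scale1r; apply/matrixP=> k l.
rewrite !mxE /undirected mulnC [underlying M l k]adj_sym [~~ arc M l k && _]andbC.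
set w := (Num.sqrt _)^-1.
case: ifP => _; first by apply/eqP; rewrite eq_complex /= oppr0 !eqxx.
have := @arc_asym _ M k l.
case: (arc M k l); case: (arc M l k) => H; try (by have := H isT); clear H;
  by apply/eqP; rewrite eq_complex /=; simpc; rewrite ?eqxx.
Qed.

(* R_H(M) is Hermitian, so that its spectrum is indeed real. *)
Lemma herm_randic_spectrum (R : rcfType) (n : nat) (M : mixed_graph 'I_n) :
  exists mu : n.-tuple R, is_real_spectrum (herm_randic R M) mu.
Proof.
set A := herm_randic R M.
have hA : A \is hermsymmx := herm_randic_herm R M.
have /orthomx_spectralP dA := hermitian_normalmx hA.
have /mxOverP rA := hermitian_spectral_diag_real hA.
move: dA rA (spectral_unit A).
move: (spectral_diag A) (spectralmx A) => D P dA rA uP.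
pose s := sort >=%R [seq complex.Re (D 0 i) | i <- enum 'I_n].
have ss : size s == n by rewrite size_sort size_map size_enum_ord.
exists (Tuple ss); split; first by apply: sort_sorted => x y; exact: le_total.
rewrite /= (perm_big _ (permEl (perm_sort _ _))) big_map big_enum /=.
have -> : char_poly A = char_poly (diag_mx D).
  pose Q := map_mx polyC P; pose Q' := map_mx polyC (invmx P).
  have QQ : Q' *m Q = 1%:M by rewrite -map_mxM mulVmx // map_mx1.
  have -> : char_poly A = \det (Q' *m char_poly_mx (diag_mx D) *m Q).
    congr (\det _); rewrite /char_poly_mx mulmxBr mulmxBl -!map_mxM -dA.
    by rewrite scalar_mxC -mulmxA QQ mulmx1.
  by rewrite !det_mulmx mulrAC -det_mulmx QQ det1 mul1r.
rewrite char_poly_trig ?diag_mx_is_trig //.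
apply: eq_bigr => i _; congr ('X - _%:P).
by rewrite mxE eqxx mulr1n RRe_real // rA.
Qed.

(* Main.v *)
(* Write A for the Hermitian-Randić matrix, E for the energy and S for
   tr (A^2), which is both the sum of the squared eigenvalues and the sum of
   1 / (d_k d_l) over adjacent pairs (k, l).  Since 1 <= d_l <= n - 1 and the
   d_k neighbours of k contribute 1 to the sum of the 1 / d_k, we get
   n / (n - 1) <= S <= n, with equality on the left exactly for complete graphs
   and on the right exactly when all degrees are 1.
   Upper bound: |x| <= (x^2 + 1) / 2 gives E <= (S + n) / 2 <= n; if all degrees
   are 1 then A^2 = 1, so that every eigenvalue has modulus 1.
   Lower bound: the eigenvalues sum to 0, hence each |x| is at most E / 2 and
   2 S <= E^2, with equality iff every nonzero eigenvalue has modulus E / 2. *)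
Require Import Defs.
From mathcomp Require Import all_boot all_order all_algebra.
From mathcomp Require Import complex.
From mathcomp Require Import reals.
From mathcomp Require Import ring lra zify.

Import Order.TTheory GRing.Theory Num.Theory.
Local Open Scope ring_scope.
Local Open Scope complex_scope.

(** * Spectra of Hermitian matrices: diagonalization, traces, involutions *)

Lemma char_poly_simmx (F : fieldType) (n : nat) (P A B : 'M[F]_n) :
  P \in unitmx -> P *m A = B *m P -> char_poly A = char_poly B.
Proof.
move=> uP PA; have dP : \det (map_mx polyC P) != 0.
  by rewrite det_map_mx polyC_eq0 -unitfE -unitmxE.
(* Cancelling the nonzero [\det P] leaves P (X - A) = (X - B) P to check. *)
apply: (mulfI dP); rewrite [RHS]mulrC -!det_mulmx; congr (\det _).
rewrite /char_poly_mx mulmxBr mulmxBl -!map_mxM PA.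
by rewrite scalar_mxC.
Qed.

(** The spectral theorem provides [P] and [D]; [char_poly A] splits along [mu] and along [D], and
    linear factors are unique up to order. *)
Lemma real_spectrum_diag (R : rcfType) (n : nat) (A : 'M[R[i]]_n)
    (mu : n.-tuple R) :
  A \is hermsymmx -> is_real_spectrum A mu ->
  exists (P : 'M[R[i]]_n) (D : 'rV[R[i]]_n),
    [/\ P \in unitmx, A = invmx P *m diag_mx D *m P
      & perm_eq [seq x%:C | x <- mu] [seq D 0 i | i <- enum 'I_n]].
Proof.
move=> hA [_ charA]; have /orthomx_spectralP dA := hermitian_normalmx hA.
exists (spectralmx A), (spectral_diag A); split => //; first exact: spectral_unit.
apply: prod_XsubC_eq; rewrite big_map -charA big_map big_enum /=.
have -> : char_poly A = char_poly (diag_mx (spectral_diag A)).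
  apply: (@char_poly_simmx _ _ (spectralmx A)); first exact: spectral_unit.
  by rewrite {2}dA !mulmxA mulmxV ?spectral_unit // mul1mx.
rewrite char_poly_trig ?diag_mx_is_trig //.
by apply: eq_bigr => i _; rewrite mxE eqxx mulr1n.
Qed.

Lemma real_spectrum_trace (R : rcfType) (n : nat) (A : 'M[R[i]]_n)
    (mu : n.-tuple R) :
  A \is hermsymmx -> is_real_spectrum A mu ->
  \tr A = (\sum_(x <- mu) x)%:C.
Proof.
move=> hA sA; have [P [D [uP dA pD]]] := real_spectrum_diag R n A mu hA sA.
rewrite dA mxtrace_mulC mulmxA mulmxV // mul1mx mxtrace_diag raddf_sum /=.
by rewrite -(big_map (fun x => x%:C) xpredT id) (perm_big _ pD) big_map big_enum.
Qed.

Lemma real_spectrum_trace_sqr (R : rcfType) (n : nat) (A : 'M[R[i]]_n)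
    (mu : n.-tuple R) :
  A \is hermsymmx -> is_real_spectrum A mu ->
  \tr (A *m A) = (\sum_(x <- mu) x ^+ 2)%:C.
Proof.
move=> hA sA; have [P [D [uP dA pD]]] := real_spectrum_diag R n A mu hA sA.
have -> : A *m A = invmx P *m (diag_mx D *m diag_mx D) *m P.
  by rewrite {1 2}dA -!mulmxA [P *m (invmx P *m _)]mulmxA mulmxV // mul1mx.
rewrite mxtrace_mulC mulmxA mulmxV // mul1mx mulmx_diag mxtrace_diag raddf_sum /=.
under [RHS]eq_bigr => x _ do rewrite rmorphXn /=.
rewrite -(big_map (fun x => x%:C) xpredT (fun z => z ^+ 2)) (perm_big _ pD).
by rewrite big_map big_enum; apply: eq_bigr => i _; rewrite mxE expr2.
Qed.

(** An eigenvector v for x satisfies v = v A^2 = x^2 v, so x^2 = 1. *)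
Lemma real_spectrum_involution (R : rcfType) (n : nat) (A : 'M[R[i]]_n)
    (mu : n.-tuple R) (x : R) :
  is_real_spectrum A mu -> A *m A = 1%:M -> x \in mu -> `|x| = 1.
Proof.
move=> [_ charA] AA xmu.
have /eigenvalueP[v vA v0] : eigenvalue A x%:C.
  rewrite eigenvalue_root_char charA -(big_map (fun x => x%:C) xpredT
    (fun z => 'X - z%:P)) root_prod_XsubC; exact: map_f.
have : v = (x ^+ 2)%:C *: v.
  by rewrite -[LHS]mulmx1 -AA mulmxA vA -scalemxAl vA scalerA rmorphXn expr2.
move=> /eqP; rewrite -subr_eq0 -[X in X - _]scale1r -scalerBl scaler_eq0 (negPf v0).
rewrite orbF subr_eq0 => /eqP /(congr1 (@complex.Re R)) /= /esym /eqP.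
by rewrite sqrf_eq1 => /orP[]/eqP->; rewrite ?normrN normr1.
Qed.

(** * The sum of 1 / (d_u d_v) over adjacent pairs and its bounds *)

Lemma sum_neighbours_inv (R : numFieldType) (T : finType) (G : sgraph T) (u : T) :
  (0 < deg G u)%N -> \sum_(v | G u v) (deg G u)%:R^-1 = 1 :> R.
Proof.
move=> d0; rewrite sumr_const -[#|_|]/(#|G u|).
have -> : #|G u| = deg G u by apply: eq_card => v; rewrite inE.
by rewrite -[LHS]mulr_natl mulfV // pnatr_eq0 -lt0n.
Qed.

(** Twice the general Randić index of exponent -1, as each edge is summed in both directions. *)
Definition randic_sum (R : numFieldType) (T : finType) (G : sgraph T) : R :=
  \sum_u \sum_(v | G u v) ((deg G u)%:R * (deg G v)%:R)^-1.

(** Termwise, 1 / (d_u d_v) <= 1 / d_u with equality iff d_v = 1, and the 1 / d_u add up to the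
    order of the graph. *)
Lemma randic_sum_leif (R : numFieldType) (T : finType) (G : sgraph T) :
  no_isolated G ->
  randic_sum R T G <= #|T|%:R ?= iff [forall u, deg G u == 1%N].
Proof.
(* [C] is the equality condition that [leif_sum] produces. It ranges over neighbours only, but
   without isolated vertices every vertex is a neighbour. *)
move=> dG; pose C := [forall u, [forall (v | G u v), deg G v == 1%N]].
have -> : [forall u, deg G u == 1%N] = C.
  apply/forallP/forallP => [h u|h v]; first by apply/forall_inP => v _.
  have /card_gt0P[u] := dG v; rewrite inE adj_sym => uv.
  by have /forall_inP/(_ v uv) := h u.
have -> : #|T|%:R = \sum_u \sum_(v | G u v) (deg G u)%:R^-1 :> R.
  by rewrite (eq_bigr (fun=> 1)) ?sumr_const // => u _; apply: sum_neighbours_inv.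
apply: leif_sum => u _; apply: leif_sum => v _.
have du : 0 < (deg G u)%:R :> R by rewrite ltr0n.
have dv : 0 < (deg G v)%:R :> R by rewrite ltr0n.
split.
  by rewrite lef_pV2 ?posrE ?mulr_gt0 // ler_pMr // ler1n.
rewrite (inj_eq invr_inj) -[X in _ == X]mulr1 (inj_eq (mulfI (lt0r_neq0 du))).
by rewrite pnatr_eq1.
Qed.

Lemma deg_leqif (T : finType) (G : sgraph T) (u : T) :
  (deg G u <= #|T|.-1 ?= iff [forall (v | v != u), G u v])%N.
Proof.
have <- : #|[set~ u]| = #|T|.-1 by rewrite cardsC1.
have sub : [set v | G u v] \subset [set~ u].
  apply/subsetP => v; rewrite !inE; apply: contraTneq => ->.
  by rewrite adj_irrefl.
have -> : [forall (v | v != u), G u v] = ([set~ u] \subset [set v | G u v]).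
  apply/forall_inP/subsetP => h v; first by rewrite !inE; apply: h.
  by move=> vu; have := h v; rewrite !inE; apply.
exact: subset_leqif_card.
Qed.

Lemma complete_graphP (T : finType) (G : sgraph T) :
  reflect (complete_graph G) [forall u, deg G u == #|T|.-1].
Proof.
apply: (iffP forallP) => [h u v uv|h u].
  have := h u; rewrite (deg_leqif T G u).2 => /forall_inP; apply.
  by rewrite eq_sym.
by rewrite (deg_leqif T G u).2; apply/forall_inP => v vu; apply: h; rewrite eq_sym.
Qed.

(** Termwise comparison with 1 / (d_u (n - 1)) for n = [#|T|]; over the neighbours of u these bounds
    add up to 1 / (n - 1). *)
Lemma randic_sum_geif (R : numFieldType) (T : finType) (G : sgraph T) :
  no_isolated G -> (1 < #|T|)%N ->
  #|T|%:R / (#|T|%:R - 1) <= randic_sum R T G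
    ?= iff [forall u, deg G u == #|T|.-1].
Proof.
move=> dG T1; pose C := [forall u, [forall (v | G u v), deg G v == #|T|.-1]].
have -> : [forall u, deg G u == #|T|.-1] = C.
  apply/forallP/forallP => [h u|h v]; first by apply/forall_inP => v _.
  have /card_gt0P[u] := dG v; rewrite inE adj_sym => uv.
  by have /forall_inP/(_ v uv) := h u.
have -> : #|T|%:R - 1 = #|T|.-1%:R :> R.
  by case: #|T| T1 => // m _; rewrite /= -natr1 addrK.
have T0 : 0 < #|T|.-1%:R :> R by rewrite ltr0n; lia.
have -> : #|T|%:R / #|T|.-1%:R =
    \sum_u \sum_(v | G u v) ((deg G u)%:R * #|T|.-1%:R)^-1 :> R.
  under eq_bigr => u _.
    under eq_bigr => v _ do rewrite invfM.
    rewrite -mulr_suml sum_neighbours_inv // mul1r; over.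
  by rewrite sumr_const mulr_natl.
apply: leif_sum => u _; apply: leif_sum => v _.
have du : 0 < (deg G u)%:R :> R by rewrite ltr0n.
have dv : 0 < (deg G v)%:R :> R by rewrite ltr0n.
split.
  rewrite lef_pV2 ?posrE ?mulr_gt0 // ler_pM2l // ler_nat.
  exact: (deg_leqif T G v).1.
rewrite (inj_eq invr_inj) (inj_eq (mulfI (lt0r_neq0 du))).
by rewrite eqr_nat eq_sym.
Qed.

(** * Traces of the Hermitian-Randić matrix and of its square *)

Lemma herm_randic_mulC (R : rcfType) (n : nat) (M : mixed_graph 'I_n) k l :
  herm_randic R M k l * herm_randic R M l k =
  (if underlying M k l
   then ((deg (underlying M) k)%:R * (deg (underlying M) l)%:R)^-1 else 0)%:C.
Proof.
rewrite !mxE /undirected [(deg _ l * _)%N]mulnC [underlying M l k]adj_sym.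
set w := (Num.sqrt _)^-1.
have -> : ((deg (underlying M) k)%:R * (deg (underlying M) l)%:R)^-1 = w * w.
  by rewrite -invfM -expr2 sqr_sqrtr ?ler0n // natrM.
(* In each orientation that these facts allow, the two entries are conjugate of modulus [w], or both
   zero. *)
move: (@arc_asym _ M k l) (@arc_adj _ M k l) (@arc_adj _ M l k).
rewrite [underlying M l k]adj_sym.
case: (Defs.arc M k l); case: (Defs.arc M l k); case: (underlying M k l) => //= H1 H2 H3;
  try (by have := H1 isT); try (by have := H2 isT); try (by have := H3 isT);
  by apply/eqP; rewrite eq_complex /=; simpc; rewrite ?eqxx.
Qed.

Lemma herm_randic_trace (R : rcfType) (n : nat) (M : mixed_graph 'I_n) :
  \tr (herm_randic R M) = 0.
Proof.
rewrite /mxtrace big1 // => k _; rewrite mxE /undirected adj_irrefl /=.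
suff -> : Defs.arc M k k = false by [].
by apply/negP => /arc_adj; rewrite adj_irrefl.
Qed.

Lemma herm_randic_trace_sqr (R : rcfType) (n : nat) (M : mixed_graph 'I_n) :
  \tr (herm_randic R M *m herm_randic R M) = (randic_sum R _ (underlying M))%:C.
Proof.
rewrite raddf_sum; apply: eq_bigr => k _; rewrite mxE raddf_sum [RHS]big_mkcond /=.
by apply: eq_bigr => l _; rewrite herm_randic_mulC; case: ifP.
Qed.

(** * Graphs whose degrees are all 1 *)

Lemma deg1_neighbour (T : finType) (G : sgraph T) (u v w : T) :
  deg G u = 1%N -> G u v -> G u w -> v = w.
Proof.
move=> /eqP/cards1P[x E] uv uw.
have: v \in [set v | G u v] by rewrite inE.
have: w \in [set v | G u v] by rewrite inE.
by rewrite E !inE => /eqP-> /eqP->.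
Qed.

(** Off the diagonal, a nonzero term of the product needs a common neighbour of two distinct
    vertices, which would have degree at least 2. A diagonal entry is the sum of 1 / d_k over the
    neighbours of k. *)
Lemma herm_randic_involution (R : rcfType) (n : nat) (M : mixed_graph 'I_n) :
  (forall u, deg (underlying M) u = 1%N) ->
  herm_randic R M *m herm_randic R M = 1%:M.
Proof.
move=> d1; have A0 k l : ~~ underlying M k l -> herm_randic R M k l = 0.
  move=> kl; rewrite mxE /undirected (negPf kl) /=.
  case: ifP => [/arc_adj h|_]; first by rewrite h in kl.
  by case: ifP => [/arc_adj h|//]; rewrite adj_sym h in kl.
apply/matrixP => k l; rewrite !mxE.
have [<-|kl] := eqVneq k l.
  under eq_bigr => j _ do rewrite herm_randic_mulC.
  rewrite -raddf_sum -big_mkcond /=.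
  under eq_bigr => j kj do rewrite (d1 j) mulr1.
  by rewrite sum_neighbours_inv ?d1.
rewrite big1 // => j _.
have [kj|/A0->] := boolP (underlying M k j); last by rewrite mul0r.
have [jl|/A0->] := boolP (underlying M j l); last by rewrite mulr0.
case/eqP: kl; apply: deg1_neighbour (d1 j) _ jl.
by rewrite adj_sym.
Qed.

Lemma path_graph1E (i j : 'I_2) : path_graph 1 i j = (i != j).
Proof. by case: i j => [[|[|//]] ?] [[|[|//]] ?]. Qed.

Lemma matching_iso (n : nat) (G : sgraph 'I_n) :
  (forall u, deg G u = 1%N) <->
  ~~ odd n /\ sgraph_iso G (copies n./2 (path_graph 1)).
Proof.
split=> [d1|[_ [f [g fK gK] fG]] u]; last first.
  (* The only neighbour of [u] is the other end of its copy; [rev_ord] swaps the two vertices of the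
     path. *)
  apply/eqP/cards1P; exists (g ((f u).1, rev_ord (f u).2)).
  apply/setP => v; rewrite !inE fG /= /copies_rel path_graph1E.
  rewrite -(inj_eq (can_inj fK) v) gK; case: (f u) (f v) => [a b] [c d] /=.
  rewrite xpair_eqE [c == a]eq_sym; congr andb.
  by case: b d => [[|[|//]] ?] [[|[|//]] ?].
have ex u : {v | G u v}.
  apply: sigW; have /card_gt0P[v] : (0 < deg G u)%N by rewrite d1.
  by rewrite inE; exists v.
(* Sending each vertex to its unique neighbour is an involution without fixed points. *)
pose f u := sval (ex u); have Gf u : G u (f u) by apply: (svalP (ex u)).
have GE u v : G u v = (v == f u).
  by apply/idP/eqP => [uv|-> //]; apply: deg1_neighbour (d1 u) uv (Gf u).
have fK : involutive f.
  by move=> u; apply/esym/eqP; rewrite -GE adj_sym.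
have fN u : f u != u by apply: contraTneq (Gf u) => ->; rewrite adj_irrefl.
(* [S] keeps the smaller end of each edge, so it indexes the edges, and [f] exchanges it with its
   complement. *)
pose S := [set u : 'I_n | (u < f u)%N].
have SC : ~: S = f @: S.
  apply/setP => u; rewrite !inE -[u in RHS]fK mem_imset; last exact: can_inj fK.
  rewrite inE fK -leqNgt leq_eqVlt [_ == _ :> nat](negPf (fN u)) //.
have nS : n = #|S|.*2.
  have := cardsC S; rewrite SC card_imset; last exact: can_inj fK.
  by rewrite card_ord addnn.
have n2 : #|S| = n./2 by rewrite [in RHS]nS doubleK.
split; first by rewrite [n in odd n]nS odd_double.
(* [m u] is the smaller end of the edge at [u], so [m] identifies exactly the two ends of each
   edge. *)
pose m u := if u \in S then u else f u.
have mS u : m u \in S.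
  by rewrite /m; case: ifPn => //; rewrite -in_setC SC => /imsetP[v vS ->]; rewrite fK.
have fS u : (f u \in S) = (u \notin S).
  by rewrite !inE fK -leqNgt ltn_neqAle [_ == _ :> nat](negPf (fN u)).
have mE u v : (m u == m v) = (u == v) || (v == f u).
  rewrite /m; have vf : (v == f u) = (u == f v) by rewrite -(inj_eq (can_inj fK)) fK eq_sym.
  have [uS|uS] := boolP (u \in S); have [vS|vS] := boolP (v \in S).
  - case: (eqVneq v (f u)) => [E|_]; last by rewrite orbF.
    by rewrite E fS uS in vS.
  - case: (eqVneq u v) => [E|_]; last by rewrite vf.
    by rewrite E (negPf vS) in uS.
  - case: (eqVneq u v) => [E|_]; last by rewrite eq_sym.
    by rewrite E vS in uS.
  - rewrite (inj_eq (can_inj fK)); case: (eqVneq v (f u)) => [E|_]; last by rewrite orbF.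
    by rewrite E fS uS in vS.
pose r u := cast_ord n2 (enum_rank_in (mS u) (m u)).
have rE u v : (r u == r v) = (u == v) || (v == f u).
  rewrite -mE (inj_eq (@cast_ord_inj _ _ n2)); apply/eqP/eqP => [/(congr1 enum_val)|E].
    by rewrite !enum_rankK_in.
  by apply: enum_val_inj; rewrite !enum_rankK_in.
(* The first coordinate numbers the edge, the second tells its smaller end from its larger one. *)
exists (fun u => (r u, if u \in S then ord0 else ord_max)).
  apply: inj_card_bij; last first.
    by rewrite card_prod !card_ord muln2 -n2 -nS.
  move=> u v /eqP; rewrite xpair_eqE rE => /andP[/orP[/eqP//|/eqP->]].
  by rewrite fS; case: (u \in S).
move=> u v; rewrite GE /= /copies_rel path_graph1E /= rE.
case: (eqVneq v (f u)) => [->|_]; first by rewrite orbT fS; case: (u \in S).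
by case: eqVneq => [->|]; rewrite ?eqxx.
Qed.

(** * Real sequences with zero sum, and the energy *)

Lemma sum0_norm_le_half (R : realDomainType) (s : seq R) (x : R) :
  \sum_(y <- s) y = 0 -> x \in s -> `|x| *+ 2 <= \sum_(y <- s) `|y|.
Proof.
move=> s0 xs; move: s0; rewrite !(big_rem x xs) /= => /eqP; rewrite addr_eq0 => /eqP xE.
(* As [x] is minus the sum of the other entries, the triangle inequality applies. *)
by rewrite mulr2n lerD2l {1}xE normrN ler_norm_sum.
Qed.

(* Each [`|x|] is at most [E / 2], hence [2 x ^+ 2 <= E * `|x|]; sum over [x]. *)
Lemma sum0_sqr_leif (R : realFieldType) (s : seq R) :
  \sum_(x <- s) x = 0 ->
  (\sum_(x <- s) x ^+ 2) *+ 2 <= (\sum_(x <- s) `|x|) ^+ 2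
    ?= iff all (fun x => (x == 0) || (`|x| *+ 2 == \sum_(y <- s) `|y|)) s.
Proof.
move=> s0; set E := \sum_(x <- s) `|x|.
have h x : x \in s -> 0 <= `|x| * (E - `|x| *+ 2).
  by move=> xs; rewrite mulr_ge0 // subr_ge0 sum0_norm_le_half.
have D : E ^+ 2 - (\sum_(x <- s) x ^+ 2) *+ 2 = \sum_(x <- s) `|x| * (E - `|x| *+ 2).
  rewrite expr2 {1}/E mulr_suml -sumrMnl -sumrB; apply: eq_bigr => x _.
  by rewrite -(real_normK (num_real x)); ring.
split; first by rewrite -subr_ge0 D big_seq sumr_ge0.
rewrite eq_sym -subr_eq0 D big_seq_cond psumr_eq0 => [|x]; last first.
  by rewrite andbT; apply: h.
apply: eq_in_all => x xs; rewrite xs /= mulf_eq0 normr_eq0 subr_eq0.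
by rewrite [E == _]eq_sym.
Qed.

Lemma energy_ge0 (R : rcfType) (n : nat) (mu : n.-tuple R) : 0 <= energy mu.
Proof. exact: sumr_ge0. Qed.

Lemma energy_le_sqr (R : rcfType) (n : nat) (mu : n.-tuple R) :
  energy mu *+ 2 <= \sum_(x <- mu) x ^+ 2 + n%:R.
Proof.
have -> : n%:R = \sum_(x <- mu) 1 :> R.
  by rewrite big_const_seq count_predT size_tuple iter_addr_0.
rewrite -sumrMnl -big_split /=; apply: ler_sum => x _.
rewrite -(real_normK (num_real x)) -subr_ge0.
by have := sqr_ge0 (`|x| - 1); rewrite sqrrB1; lra.
Qed.

(** Isolates the largest and the smallest entry of a sorted spectrum; [2 <= n] keeps their positions
    distinct. *)
Lemma big_nth_ends (V W : nmodType) (n : nat) (s : seq V) (F : V -> W) :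
  size s = n -> (2 <= n)%N ->
  \sum_(x <- s) F x = F s`_0 + F s`_n.-1 + \sum_(1 <= j < n.-1) F s`_j.
Proof.
move=> sz n2; rewrite (big_nth 0) sz big_ltn; last by lia.
rewrite -{1}(prednK (ltnW n2)) big_nat_recr /=; last by lia.
by rewrite addrA addrAC.
Qed.

(** In the equality case every entry is 0 or has modulus E / 2. Zero sum and E > 0 make the first
    entry positive and the last one negative, so these two exhaust the energy and the others
    vanish. *)
Lemma extremal_spectrum (R : rcfType) (n : nat) (mu : n.-tuple R) :
  (2 <= n)%N -> sorted >=%R mu -> \sum_(x <- mu) x = 0 -> 0 < energy mu ->
  (\sum_(x <- mu) x ^+ 2) *+ 2 = energy mu ^+ 2 <->
  [/\ mu`_0 = - mu`_(n.-1), mu`_0 != 0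
    & forall j : nat, (0 < j < n.-1)%N -> mu`_j = 0].
Proof.
move=> n2 mus mu0 E0; have sz := size_tuple mu.
split=> [/eqP|[m0 _ mj]]; last first.
  have mid (F : R -> R) : F 0 = 0 -> \sum_(x <- mu) F x = F mu`_0 + F mu`_n.-1.
    move=> F0; rewrite (big_nth_ends _ _ _ _ _ sz n2) big_nat big1 ?addr0 //.
    by move=> j /mj->.
  rewrite /energy !mid ?normr0 ?expr0n // m0 normrN sqrrN.
  by rewrite -(real_normK (num_real _)); ring.
rewrite (sum0_sqr_leif _ _ mu0).2 => /allP h.
have hj j : (j < n)%N -> mu`_j = 0 \/ `|mu`_j| *+ 2 = energy mu.
  move=> jn; have := h mu`_j; rewrite mem_nth ?sz //= => /(_ isT).
  by case/orP=> /eqP; auto.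
have le i j : (i <= j < n)%N -> mu`_j <= mu`_i.
  move=> /andP[ij jn]; apply: (sorted_leq_nth ge_trans ge_refl 0 mus) => //;
  rewrite inE sz //; exact: leq_ltn_trans jn.
have n0 : (0 < n)%N := ltnW n2.
(* Otherwise no entry is positive, and the energy is minus the zero sum. *)
have top : 0 < mu`_0.
  rewrite ltNge; apply/negP => t0; suff : energy mu = 0 by lra.
  transitivity (- \sum_(x <- mu) x); last by rewrite mu0 oppr0.
  rewrite -sumrN; apply: eq_big_seq => x /(nthP 0)[j].
  rewrite sz => jn <-; rewrite ler0_norm //; apply: le_trans t0; exact: le.
have bot : mu`_n.-1 < 0.
  rewrite ltNge; apply/negP => t0; suff : energy mu = 0 by lra.
  rewrite -[RHS]mu0; apply: eq_big_seq => x /(nthP 0)[j].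
  rewrite sz => jn <-; rewrite ger0_norm //; apply: le_trans t0 _; apply: le; lia.
have topE : mu`_0 *+ 2 = energy mu.
  by case: (hj 0%N n0); rewrite ?gtr0_norm //; lra.
have botE : - mu`_n.-1 *+ 2 = energy mu.
  by case: (hj n.-1); rewrite ?ltr0_norm //; [lia|lra].
split; [lra|lra|] => j jn.
have : \sum_(1 <= j < n.-1) `|mu`_j| = 0.
  have := big_nth_ends _ _ _ _ Num.norm sz n2; rewrite -/(energy mu).
  by rewrite gtr0_norm // ltr0_norm //; lra.
rewrite big_nat big_mkcond /= big_mkcond /= => /eqP.
rewrite psumr_eq0; last by move=> i _; case: ifP.
move=> /allP/(_ j); rewrite mem_index_iota jn /= normr_eq0 => /(_ isT)/eqP //.
Qed.

(** * The two energy bounds and their equality cases *)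

Theorem theorem3p8 (R : realType) (n : nat) (M : mixed_graph 'I_n)
    (mu : n.-tuple R) :
  (3 <= n)%N ->
  no_isolated (underlying M) ->
  is_real_spectrum (herm_randic R M) mu ->
  [/\ Num.sqrt (2 * n%:R / (n%:R - 1)) <= energy mu <= n%:R,
      energy mu = n%:R <->
        ~~ odd n /\ sgraph_iso (underlying M) (copies n./2 (path_graph 1))
    & energy mu = Num.sqrt (2 * n%:R / (n%:R - 1)) <->
        complete_graph (underlying M) /\
        [/\ mu`_0 = - mu`_(n.-1), mu`_0 != 0
          & forall j : nat, (0 < j < n.-1)%N -> mu`_j = 0]].
Proof.
move=> n3 dG sA; set G := underlying M in dG *.
have hA := herm_randic_herm R M.
have mu0 : \sum_(x <- mu) x = 0.
  by have := real_spectrum_trace _ _ _ _ hA sA; rewrite herm_randic_trace => -[].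
have muS : \sum_(x <- mu) x ^+ 2 = randic_sum R _ G.
  by have := real_spectrum_trace_sqr _ _ _ _ hA sA; rewrite herm_randic_trace_sqr => -[].
have S_le := randic_sum_leif R _ _ dG.
have S_ge : n%:R / (n%:R - 1) <= randic_sum R _ G ?= iff [forall u, deg G u == n.-1].
  by have := randic_sum_geif R _ _ dG; rewrite card_ord; apply; lia.
rewrite card_ord in S_le.
have E_ge := sum0_sqr_leif _ _ mu0; rewrite -/(energy mu) muS in E_ge.
have E_le := energy_le_sqr _ _ mu; rewrite muS in E_le.
have E_ge0 := energy_ge0 _ _ mu.
have n1 : 0 < n%:R - 1 :> R by rewrite subr_gt0 ltr1n; lia.
have q0 : 0 < n%:R / (n%:R - 1) :> R by rewrite divr_gt0 // ltr0n; lia.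
(* Zero energy would give 2 S <= 0, against S >= n / (n - 1) > 0. *)
have E_gt0 : 0 < energy mu.
  rewrite lt0r E_ge0 andbT; apply/eqP => E0.
  by have := E_ge.1; have := S_ge.1; rewrite E0 expr0n /=; lra.
have sqrtE : energy mu = Num.sqrt (2 * n%:R / (n%:R - 1)) <->
    energy mu ^+ 2 = (n%:R / (n%:R - 1)) *+ 2.
  rewrite -mulrA mulr_natl; split=> [->|<-]; last by rewrite sqrtr_sqr ger0_norm.
  by rewrite sqr_sqrtr // mulrn_wge0 // ltW.
split.
- apply/andP; split; last by have := S_le.1; lra.
  rewrite -(ger0_norm E_ge0) -sqrtr_sqr ler_wsqrtr //.
  by have := E_ge.1; have := S_ge.1; lra.
- apply: iff_trans (matching_iso _ _); split=> [E|d1].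
    (* From 2 n = 2 E <= S + n <= 2 n follows S = n. *)
    have /eqP : randic_sum R _ G = n%:R by have := S_le.1; lra.
    by rewrite S_le.2 => /forallP d1 u; apply/eqP.
  have AA := herm_randic_involution R _ _ d1.
  rewrite /energy (eq_big_seq (fun=> 1)) => [|x xmu]; last first.
    exact: real_spectrum_involution sA AA xmu.
  by rewrite big_const_seq count_predT size_tuple iter_addr_0.
have ext := extremal_spectrum _ _ _ (ltnW n3) sA.1 mu0 E_gt0; rewrite muS in ext.
have cmpl := complete_graphP _ G; rewrite card_ord -S_ge.2 in cmpl.
apply: iff_trans sqrtE _; split=> [E|[/cmpl/eqP S /ext <-]]; last by rewrite S.
(* Equality of the ends of 2 n / (n - 1) <= 2 S <= E^2 makes both steps tight: the first means
   completeness, the second the extremal spectrum. *)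
have SE : n%:R / (n%:R - 1) = randic_sum R _ G.
  by have := S_ge.1; have := E_ge.1; lra.
by split; [apply/cmpl/eqP | apply/ext; rewrite -SE].
Qed.
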